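(* Let $W = W^\top \ge 0$ be an $N\times N$ matrix satisfying $\det(\mathrm{D}\Psi(x)^\top W\, \mathrm{D}\Psi(x)) \neq 0$ for all $x \in \mathbb{X}$, and let $\pi_W$ be the associated closest-point projection. Then $$\left\| \pi_W(\hat{K}\Psi(x)) - \mathcal{K}^t\Psi(x) \right\|_W \le 2 \left\| \hat{K}\Psi(x) - \mathcal{K}^t\Psi(x) \right\|_W$$ for all $x \in \mathbb{X}$ for which $\pi_W(\hat K\Psi(x))$ is well-defined.
   Context: Let $\mathbb{X} \subset \mathbb{R}^d$ be compact, $\eta > 0$, $D := \{x+y : x \in \mathbb{X},\ \|y\| < \eta\}$, and $f : D \to \mathbb{R}^d$ Lipschitz continuous. For $\hat x \in \mathbb{X}$ let $x(\cdot;\hat x)$ be the solution of $\dot x(t) = f(x(t))$, $x(0) = \hat x$; it is assumed to exist in $D$ on $[0,\Delta t]$ for all $\hat x \in \mathbb{X}$, for a given $\Delta t > 0$. Fix $t \in [0,\Delta t]$. Let $\psi_1,\dots,\psi_N \in L^2(D,\mathbb{R})$ be linearly independent and $\Psi := (\psi_1,\dots,\psi_N)^\top : D \to \mathbb{R}^N$, assumed continuously differentiable with differential $\mathrm{D}\Psi(x) \in \mathbb{R}^{N\times d}$. The Koopman operator acts by $(\mathcal{K}^t\Psi)(\hat x) := \Psi(x(t;\hat x))$; $\mathcal{K}^t\Psi(\hat x)$ denotes this value. Let $M := \{\Psi(x) : x \in \mathbb{X}\} \subset \mathbb{R}^N$, assumed to be a smooth $d$-dimensional embedded manifold. It is a standing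 assumption that $M$ is invariant under the Koopman flow, i.e. $\mathcal{K}^t\Psi(\hat x) \in M$ for all $\hat x \in \mathbb{X}$ (this holds, for instance, if $\mathbb{X}$ is forward invariant). $\hat K \in \mathbb{R}^{N\times N}$ is the solution of the regression problem $\min_{K\in\mathbb{R}^{N\times N}} \int_{\mathbb{X}} \|\Psi(x(t;\hat x)) - K\Psi(\hat x)\|_2^2\,\mathrm{d}\hat x$, given by $\hat K = \Psi_Y\Psi_X^{-1}$ with $\Psi_X = \int_{\mathbb{X}} \Psi(\hat x)\Psi(\hat x)^\top\mathrm{d}\hat x$ (assumed invertible) and $\Psi_Y = \int_{\mathbb{X}} \Psi(x(t;\hat x))\Psi(\hat x)^\top\mathrm{d}\hat x$. For symmetric positive semi-definite $W$, $\langle u_1,u_2\rangle_W := u_1^\top W u_2$ and $\|u\|_W := \sqrt{u^\top W u}$ (a semi-norm). The closest-point projection is $\pi_W(z) := \operatorname{argmin}_{p\in M}\|z-p\|_W \in M$; it is well-defined at $z$ if the minimizer exists and is unique. *)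

(* Defs.v *)
From HB Require Import structures.
From mathcomp Require Import all_boot all_order all_algebra.
From mathcomp Require Import all_classical all_reals all_analysis.

Set Implicit Arguments.
Unset Strict Implicit.
Unset Printing Implicit Defensive.

Import Order.TTheory GRing.Theory Num.Theory.
Import numFieldNormedType.Exports.

Local Open Scope classical_set_scope.
Local Open Scope ring_scope.

(** * Lebesgue measure on R^n

    Built on [n.-tuple R] with its Borel (product) sigma-algebra, by iterating
    the binary product measure; [colv] identifies tuples with column vectors. *)

Section lebesgue_tuple.
Context {R : realType}.

Local Notation RB := (measurableTypeR R).

Definition cons_pair (n : nat) (p : RB * n.-tuple RB) : n.+1.-tuple RB :=
  [the n.+1.-tuple RB of p.1 :: p.2].

Lemma measurable_cons_pair (n : nat) :
  measurable_fun [set: RB * n.-tuple RB] (@cons_pair n).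
Proof. exact: measurable_cons. Qed.

Section step.
Variables (n : nat) (m : {sigma_finite_measure set (n.-tuple RB) -> \bar R}).

Definition lebesgue_step : set (n.+1.-tuple RB) -> \bar R :=
  pushforward (@lebesgue_measure R \x m)%E (@cons_pair n).

Let mcons : measurable_fun [set: RB * n.-tuple RB] (@cons_pair n) :=
  @measurable_cons_pair n.

Let lebesgue_step0 : lebesgue_step set0 = 0%E.
Proof. exact: measure0. Qed.

Let lebesgue_step_ge0 A : (0 <= lebesgue_step A)%E.
Proof. exact: measure_ge0. Qed.

Let lebesgue_step_sigma_additive : semi_sigma_additive lebesgue_step.
Proof. exact: measure_semi_sigma_additive. Qed.

HB.instance Definition _ := isMeasure.Build _ _ _ lebesgue_step
  lebesgue_step0 lebesgue_step_ge0 lebesgue_step_sigma_additive.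

Lemma lebesgue_stepE (A : set RB) (B : set (n.-tuple RB)) :
  measurable A -> measurable B ->
  (lebesgue_step [set u | A (tnth u ord0) /\ B [tuple of behead u]] =
   lebesgue_measure A * m B)%E.
Proof.
move=> mA mB; rewrite /lebesgue_step /pushforward.
rewrite (_ : _ @^-1` _ = A `*` B); first exact: product_measure1E.
by apply/seteqP; split=> -[a u] /=; rewrite tnth0 (_ : [tuple of _] = u) //;
  exact: val_inj.
Qed.

Lemma lebesgue_step_sigma_finite : sigma_finite setT lebesgue_step.
Proof.
have /sigma_finiteP[F [FT ndF Foo]] := sigma_finiteT (@lebesgue_measure R).
have /sigma_finiteP[G [GT ndG Goo]] := sigma_finiteT m.
exists (fun k => [set u | F k (tnth u ord0) /\ G k [tuple of behead u]]).
  apply/esym; rewrite -subTset => u _.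
  have [i _ Fi] : (\bigcup_k F k) (tnth u ord0) by rewrite -FT.
  have [j _ Gj] : (\bigcup_k G k) [tuple of behead u] by rewrite -GT.
  exists (maxn i j) => //; split.
    by have /subsetPset := ndF _ _ (leq_maxl i j); exact.
  by have /subsetPset := ndG _ _ (leq_maxr i j); exact.
move=> k; have [mF Fk] := Foo k; have [mG Gk] := Goo k; split.
  apply: measurableI.
    by rewrite -[X in measurable X]setTI; exact: measurable_tnth.
  by rewrite -[X in measurable X]setTI; exact: measurable_behead.
by rewrite lebesgue_stepE// lte_mul_pinfty// ge0_fin_numE.
Qed.

HB.instance Definition _ := Measure_isSigmaFinite.Build _ _ _ lebesgue_step
  lebesgue_step_sigma_finite.

End step.

Fixpoint lebesgue_tuple (n : nat) :
    {sigma_finite_measure set (n.-tuple RB) -> \bar R} :=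
  if n is n'.+1 then lebesgue_step (lebesgue_tuple n')
  else @dirac _ (0.-tuple RB) [tuple] R.

End lebesgue_tuple.

Definition colv (R : realType) (n : nat) (u : n.-tuple (measurableTypeR R)) :
  'cV[R]_n := \col_i tnth u i.

(** * Norms and differentiability *)

Definition enorm (R : realType) (n : nat) (u : 'cV[R]_n) : R :=
  Num.sqrt (\sum_i u i 0 ^+ 2).

Definition wdot (R : realType) (n : nat) (W : 'M[R]_n) (u v : 'cV[R]_n) : R :=
  (u^T *m W *m v) 0 0.

Definition psd (R : realType) (n : nat) (W : 'M[R]_n) : Prop :=
  W^T = W /\ forall u : 'cV[R]_n, 0 <= wdot W u u.

Definition wnorm (R : realType) (n : nat) (W : 'M[R]_n) (u : 'cV[R]_n) : R :=
  Num.sqrt (wdot W u u).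

(* Only meaningful for open [U]: continuity and derivatives at a point of [U]
   are taken over full neighbourhoods. *)
Fixpoint Ck_on (R : realType) (V V' : normedModType R) (k : nat) (U : set V)
    (g : V -> V') : Prop :=
  match k with
  | 0 => forall x, U x -> {for x, continuous g}
  | k'.+1 => (forall x, U x -> differentiable g x) /\
             (forall v, Ck_on k' U (fun x => 'D_v g x))
  end.

Definition smooth_on (R : realType) (V V' : normedModType R) (U : set V)
  (g : V -> V') : Prop := forall k, Ck_on k U g.

(* The library's [jacobian] is for row vectors; this is the usual N x d matrix
   of partial derivatives. *)
Definition jac (R : realType) (d N : nat) (g : 'cV[R]_d -> 'cV[R]_N)
  (x : 'cV[R]_d) : 'M[R]_(N, d) :=
  \matrix_(i, j) ('D_(delta_mx j 0) g x) i 0.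

(** * Embedded submanifolds of R^N *)

Definition diffeo (R : realType) (n : nat) (U V : set 'cV[R]_n)
    (g g' : 'cV[R]_n -> 'cV[R]_n) : Prop :=
  [/\ smooth_on U g, smooth_on V g',
      (forall x, U x -> V (g x) /\ g' (g x) = x) &
      (forall y, V y -> U (g' y) /\ g (g' y) = y)].

(* [0, oo)^k x R^(d-k) x {0}; this is R^d x {0} when k = 0. *)
Definition slice (R : realType) (N d k : nat) : set 'cV[R]_N :=
  [set y | (forall i : 'I_N, (i < k)%N -> 0 <= y i 0) /\
           (forall i : 'I_N, (d <= i)%N -> y i 0 = 0)].

(* Slice charts with k = 0 everywhere give a manifold without boundary. Since
   the manifold of interest is the image of a compact subset of R^d (a ball or
   a box, say), boundary points (k = 1) and corners (k >= 2) are permitted. *)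
Definition embedded_submanifold (R : realType) (N d : nat)
    (M : set 'cV[R]_N) : Prop :=
  (d <= N)%N /\
  forall p, M p -> exists (U V : set 'cV[R]_N) (g g' : 'cV[R]_N -> 'cV[R]_N)
    (k : nat),
    [/\ open U, open V, U p, diffeo U V g g' &
        (k <= d)%N /\ g @` (U `&` M) = V `&` @slice R N d k].

(** * Flow, Koopman operator and regression *)

Definition tube (R : realType) (d : nat) (X : set 'cV[R]_d) (eta : R) :
    set 'cV[R]_d :=
  [set z | exists x y, [/\ X x, enorm y < eta & z = x + y]].

(* At the endpoints of [0, T] the derivative is one-sided. *)
Definition ode_solution (R : realType) (d : nat) (f : 'cV[R]_d -> 'cV[R]_d)
    (D : set 'cV[R]_d) (T : R) (x0 : 'cV[R]_d) (x : R -> 'cV[R]_d) : Prop :=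
  [/\ x 0 = x0,
      (forall s, s \in `[0, T] -> D (x s)) &
      (forall s, s \in `[0, T] ->
        h^-1 *: (x (s + h) - x s)
          @[h --> within [set h | s + h \in `[0, T]] 0^'] --> f (x s))].

(* [x s z] is the state at time [s] of the solution issued from [z]. *)
Definition koopman (R : realType) (d N : nat) (x : R -> 'cV[R]_d -> 'cV[R]_d)
  (t : R) (Psi : 'cV[R]_d -> 'cV[R]_N) : 'cV[R]_d -> 'cV[R]_N :=
  fun z => Psi (x t z).

(* Membership of [g] in L^2(D), for real-valued [g]. *)
Definition square_integrable (R : realType) (d : nat) (D : set 'cV[R]_d)
    (g : 'cV[R]_d -> R) : Prop :=
  measurable_fun (@colv R d @^-1` D) (g \o @colv R d) /\
  (\int[@lebesgue_tuple R d]_(u in @colv R d @^-1` D)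
     ((g (colv u) ^+ 2)%:E) < +oo)%E.

(* In L^2(D), a linear combination vanishes when it is null almost everywhere. *)
Definition L2_independent (R : realType) (d N : nat) (D : set 'cV[R]_d)
    (Psi : 'cV[R]_d -> 'cV[R]_N) : Prop :=
  forall c : 'I_N -> R,
    {ae @lebesgue_tuple R d, forall u, D (colv u) ->
       \sum_i c i * Psi (colv u) i 0 = 0} ->
    forall i, c i = 0.

Definition integral_cV (R : realType) (d : nat) (X : set 'cV[R]_d)
    (g : 'cV[R]_d -> R) : R :=
  \int[@lebesgue_tuple R d]_(u in @colv R d @^-1` X) g (colv u).

Definition cross_moment (R : realType) (d N : nat) (X : set 'cV[R]_d)
    (F G : 'cV[R]_d -> 'cV[R]_N) : 'M[R]_N :=
  \matrix_(i, j) integral_cV X (fun z => (F z *m (G z)^T) i j).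

Definition regression_cost (R : realType) (d N : nat) (X : set 'cV[R]_d)
    (F G : 'cV[R]_d -> 'cV[R]_N) (K : 'M[R]_N) : R :=
  integral_cV X (fun z => enorm (F z - K *m G z) ^+ 2).

(** * Closest-point projection *)

Definition closest_points (R : realType) (N : nat) (W : 'M[R]_N)
    (M : set 'cV[R]_N) (z : 'cV[R]_N) : set 'cV[R]_N :=
  [set p | M p /\ forall q, M q -> wnorm W (z - p) <= wnorm W (z - q)].

Definition proj_well_defined (R : realType) (N : nat) (W : 'M[R]_N)
    (M : set 'cV[R]_N) (z : 'cV[R]_N) : Prop :=
  exists! p, closest_points W M z p.

(* The value is junk unless [proj_well_defined W M z]. *)
Definition closest_proj (R : realType) (N : nat) (W : 'M[R]_N) (M : set 'cV[R]_N)
  (z : 'cV[R]_N) : 'cV[R]_N := xget 0 (closest_points W M z).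

(* Main.v *)
Require Import Defs.
From mathcomp Require Import all_boot all_order all_algebra.
From mathcomp Require Import all_classical all_reals all_analysis.
From mathcomp Require Import ring lra.

Import Order.TTheory GRing.Theory Num.Theory.
Import numFieldNormedType.Exports.

Local Open Scope classical_set_scope.
Local Open Scope ring_scope.

(** Let [M] be the image of [X] under [Psi], [k := koopman x t Psi z] the exact
    value, [y := Khat *m Psi z] its approximation and [p] the closest point of
    [M] to [y]. By invariance of [M] under the flow, [k] lies in [M] and hence
    competes in the minimization defining [p]: [y - p] is at most as long as
    [y - k]. The triangle inequality applied to [p - k = (y - k) - (y - p)]
    then gives the factor 2 ([wnorm_closest_proj_sub]).

    Since [W] may be singular, [wnorm W] is only a seminorm; its triangle
    inequality rests on Cauchy-Schwarz for positive semidefinite forms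
    ([wdot_CauchySchwarz]). *)

Section seminorm.
Context (R : realType) (n : nat).
Implicit Types (W : 'M[R]_n) (u v : 'cV[R]_n) (c : R).

Lemma wdotDl W u1 u2 v : wdot W (u1 + u2) v = wdot W u1 v + wdot W u2 v.
Proof. by rewrite /wdot linearD /= !mulmxDl mxE. Qed.

Lemma wdotDr W u v1 v2 : wdot W u (v1 + v2) = wdot W u v1 + wdot W u v2.
Proof. by rewrite /wdot mulmxDr mxE. Qed.

Lemma wdotZl W c u v : wdot W (c *: u) v = c * wdot W u v.
Proof. by rewrite /wdot linearZ /= -!scalemxAl mxE. Qed.

Lemma wdotZr W c u v : wdot W u (c *: v) = c * wdot W u v.
Proof. by rewrite /wdot -scalemxAr mxE. Qed.

Lemma wdotC W u v : W^T = W -> wdot W u v = wdot W v u.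
Proof.
move=> symW.
have tr_vWu : v^T *m W *m u = (u^T *m W *m v)^T.
  by rewrite !trmx_mul trmxK symW mulmxA.
by rewrite /wdot tr_vWu [in RHS]mxE.
Qed.

(** The quadratic polynomial [s |-> wdot W (u + s *: v) (u + s *: v)] is
    nonnegative, so its discriminant is nonpositive. The leading coefficient [wdot W v v] may
    vanish for [v != 0]; the polynomial is then affine, hence constant. *)
Lemma wdot_CauchySchwarz W u v :
  psd W -> wdot W u v ^+ 2 <= wdot W u u * wdot W v v.
Proof.
move=> [symW posW].
have quad_ge0 s : 0 <= wdot W u u + 2 * s * wdot W u v + s ^+ 2 * wdot W v v.
  have := posW (u + s *: v).
  rewrite !(wdotDl, wdotDr) !(wdotZl, wdotZr) (wdotC W v u symW); lra.
have [v0|v_neq0] := eqVneq (wdot W v v) 0; last first.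
  have v_gt0 : 0 < wdot W v v by rewrite lt_def v_neq0 posW.
  (* the minimizer of the quadratic polynomial *)
  have := quad_ge0 (- (wdot W u v / wdot W v v)).
  rewrite (_ : _ + _ = wdot W u u - wdot W u v ^+ 2 / wdot W v v); last by field.
  by rewrite subr_ge0 ler_pdivrMr.
rewrite v0 mulr0; have [->|uv_neq0] := eqVneq (wdot W u v) 0.
  by rewrite expr0n.
(* a nonconstant affine function takes a negative value: here, -1 *)
have := quad_ge0 (- (wdot W u u + 1) / (2 * wdot W u v)).
rewrite v0 (_ : _ + _ = -1); first by lra.
by field.
Qed.

Lemma wnormN W u : wnorm W (- u) = wnorm W u.
Proof.
by rewrite /wnorm -scaleN1r wdotZl wdotZr mulrA mulrNN mulr1 mul1r.
Qed.

Lemma ler_wnormD W u v : psd W -> wnorm W (u + v) <= wnorm W u + wnorm W v.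
Proof.
move=> psdW; have [symW posW] := psdW.
rewrite -(@ler_pXn2r _ 2) ?nnegrE ?addr_ge0 ?sqrtr_ge0 //.
rewrite sqrrD !sqr_sqrtr // !(wdotDl, wdotDr) (wdotC W v u symW).
have : wdot W u v <= wnorm W u * wnorm W v.
  rewrite -sqrtrM // (le_trans (ler_norm _)) // -sqrtr_sqr.
  by rewrite ler_wsqrtr // wdot_CauchySchwarz.
rewrite -/(wnorm W u) -/(wnorm W v) -mulr_natl; lra.
Qed.

End seminorm.

Lemma ler_wnormB (R : realType) (n : nat) (W : 'M[R]_n) (u v : 'cV[R]_n) :
  psd W -> wnorm W (u - v) <= wnorm W u + wnorm W v.
Proof. by move=> psdW; rewrite -(wnormN _ _ W v) ler_wnormD. Qed.

Lemma closest_projP (R : realType) (N : nat) (W : 'M[R]_N) (M : set 'cV[R]_N)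
    (y : 'cV[R]_N) :
  proj_well_defined W M y -> closest_points W M y (closest_proj W M y).
Proof. by move=> [p [py _]]; exact: (xgetPex 0 (ex_intro _ p py)). Qed.

(** The reason is that [k] is itself a candidate in the minimization over [M],
    so the two steps, from [k] to [y] and from [y] to its projection, are each
    at most as long as the first. *)
Lemma wnorm_closest_proj_sub (R : realType) (N : nat) (W : 'M[R]_N)
    (M : set 'cV[R]_N) (y k : 'cV[R]_N) :
  psd W -> M k -> proj_well_defined W M y ->
  wnorm W (closest_proj W M y - k) <= 2 * wnorm W (y - k).
Proof.
move=> psdW Mk /closest_projP[_ /(_ k Mk) le_pk].
set p := closest_proj W M y in le_pk *.
have -> : p - k = (y - k) - (y - p) by rewrite opprB [RHS]addrC addrA subrK.
have := ler_wnormB R N W (y - k) (y - p) psdW; lra.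
Qed.

Theorem proposition7 (R : realType) (d N : nat)
  (X : set 'cV[R]_d) (hX : compact X)
  (eta : R) (heta : 0 < eta)
  (f : 'cV[R]_d -> 'cV[R]_d) (hf : [lipschitz f z | z in tube X eta])
  (Dt : R) (hDt : 0 < Dt)
  (x : R -> 'cV[R]_d -> 'cV[R]_d)
  (hx : forall z, X z -> ode_solution f (tube X eta) Dt z (fun s => x s z))
  (t : R) (ht : 0 <= t <= Dt)
  (Psi : 'cV[R]_d -> 'cV[R]_N)
  (hL2 : forall i, square_integrable (tube X eta) (fun z => Psi z i 0))
  (hindep : L2_independent (tube X eta) Psi)
  (hC1 : Ck_on 1 (tube X eta) Psi)
  (hM : embedded_submanifold d (Psi @` X))
  (hinv : forall z, X z -> (Psi @` X) (koopman x t Psi z))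
  (hPsiX : cross_moment X Psi Psi \in unitmx)
  (Khat : 'M[R]_N)
  (hKmin : forall K, regression_cost X (koopman x t Psi) Psi Khat
                       <= regression_cost X (koopman x t Psi) Psi K)
  (hK : Khat = cross_moment X (koopman x t Psi) Psi
                 *m invmx (cross_moment X Psi Psi))
  (W : 'M[R]_N) (hW : psd W)
  (hdet : forall z, X z -> \det ((jac Psi z)^T *m W *m jac Psi z) != 0)
  (z : 'cV[R]_d) (hz : X z)
  (hproj : proj_well_defined W (Psi @` X) (Khat *m Psi z)) :
  wnorm W (closest_proj W (Psi @` X) (Khat *m Psi z) - koopman x t Psi z)
    <= 2 * wnorm W (Khat *m Psi z - koopman x t Psi z).
Proof.
exact: (wnorm_closest_proj_sub _ _ _ _ _ _ hW (hinv z hz) hproj).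
Qed.
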